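(* There exists an ergodic shift-invariant probability measure on $\Omega=\{0,1\}^{\mathbb{N}}$ that is not contained in any effectively compact class of stationary ergodic measures.
   Context: The shift $T:\Omega\to\Omega$ maps $\omega(1)\omega(2)\dots$ to $\omega(2)\omega(3)\dots$. A probability measure $P$ is stationary (shift-invariant) if $P(T^{-1}A)=P(A)$ for all Borel $A$; a Borel set $A$ is invariant if $T(A)\subseteq A$; a stationary $P$ is ergodic if every invariant Borel set has measure 0 or 1. The space $\mathcal{M}(\Omega)$ of probability measures has basic sets given by finitely many conditions $u<P(y)<v$ ($y$ a word, $u,v$ rational, $P(y)$ the probability of the set of sequences beginning with $y$). A class $\mathcal{C}\subseteq\mathcal{M}(\Omega)$ is effectively compact if it is compact and the set of finite families of basic sets covering $\mathcal{C}$ is enumerable. *)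

(* Defs.v *)
From HB Require Import structures.
From mathcomp Require Import all_boot all_order all_algebra.
From mathcomp Require Import all_classical all_reals all_analysis.

Set Implicit Arguments.
Unset Strict Implicit.
Unset Printing Implicit Defensive.

Import Order.TTheory GRing.Theory Num.Theory.

Local Open Scope classical_set_scope.
Local Open Scope ring_scope.

(* Computability: register machines with unboundedly many registers.
   [Inc r] increments register r and moves on; [Dec r j] jumps to
   instruction j if register r is zero, and otherwise decrements it and moves
   on. A run halts when the program counter leaves the program. *)
Inductive instr := Inc of nat | Dec of nat & nat.

Definition machine := seq instr.

Definition config := (nat * (nat -> nat))%type.

Definition set_reg (s : nat -> nat) (r v : nat) : nat -> nat :=
  fun q => if q == r then v else s q.

Definition step (M : machine) (c : config) : config :=
  let: (pc, s) := c in
  match onth M pc with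
  | None => c
  | Some (Inc r) => (pc.+1, set_reg s r (s r).+1)
  | Some (Dec r j) =>
      if s r is v.+1 then (pc.+1, set_reg s r v) else (j, s)
  end.

Definition computes (M : machine) (x y : nat) : Prop :=
  exists t : nat,
    let: (pc, s) := iter t (step M) (0%N, set_reg (fun=> 0%N) 0 x) in
    (size M <= pc)%N /\ s 0%N = y.

(* Outputs of a partial computable function; partiality accounts for the
   empty set. *)
Definition enumerable_nat (A : set nat) : Prop :=
  exists M : machine, A = [set y | exists x, computes M x y].

(* [pickle] is the library's Goedel numbering. It is used below only for
   lists, pairs, booleans and rationals, where it is built from
   [CodeSeq.code] and is effective. *)
Definition enumerable (T : countType) (A : set T) : Prop :=
  enumerable_nat (pickle @` A).

Definition Omega := g_sigma_algebraType (@open cantor_space).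

Definition shift (w : Omega) : Omega := fun n => w n.+1.

Definition cylinder (y : seq bool) : set Omega :=
  [set w | forall i, (i < size y)%N -> w i = nth false y i].

(* A condition ((y, u), v) stands for u < P(y) < v. *)
Definition cond := (seq bool * rat * rat)%type.

Definition basic_code := seq cond.
HB.instance Definition _ := Countable.on basic_code.
HB.instance Definition _ := isPointed.Build basic_code [::].

Section measures.
Variable R : realType.
Implicit Types P : probability Omega R.

Definition stationary P : Prop :=
  forall A : set Omega, measurable A -> P (shift @^-1` A) = P A.

Definition invariant (A : set Omega) : Prop := shift @` A `<=` A.

Definition ergodic P : Prop :=
  stationary P /\
  forall A : set Omega, measurable A -> invariant A ->
    P A = 0%E \/ P A = 1%E.

Definition satisfies P (c : cond) : Prop :=
  let: (y, u, v) := c in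
  ((ratr u)%:E < P (cylinder y) < (ratr v)%:E)%E.

Definition basic (b : basic_code) : set (probability Omega R) :=
  [set P | forall c, c \in (b : seq cond) -> satisfies P c].

Lemma basic_cover : \bigcup_(b in [set: basic_code]) basic b = setT.
Proof. by apply/seteqP; split=> // P _; exists [::]. Qed.

Lemma basic_join (b1 b2 : basic_code) P :
  setT b1 -> setT b2 -> basic b1 P -> basic b2 P ->
  exists b, [/\ setT b, basic b P & basic b `<=` basic b1 `&` basic b2].
Proof.
move=> _ _ P1 P2; exists (b1 ++ b2); split=> //.
  by move=> c; rewrite mem_cat => /orP[/P1|/P2].
by move=> Q bQ; split=> c cb; apply: bQ; rewrite mem_cat cb ?orbT.
Qed.

HB.instance Definition _ := isBaseTopological.Build (probability Omega R)
  basic_cover basic_join.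

Definition covers (F : seq basic_code) (C : set (probability Omega R)) : Prop :=
  C `<=` \bigcup_(b in [set` F]) basic b.

Definition effectively_compact (C : set (probability Omega R)) : Prop :=
  compact C /\ enumerable [set F : seq basic_code | covers F C].

End measures.

(* Main.v *)
(** Only countably many sets of finite covers are enumerable, and a compact
    class is controlled by its finite covers, so effectivity is used only
    through countability; the rest is a Baire category argument.

    For a real number [a], let [P_a] be the law of the itinerary of a uniform
    random point of the circle R/Z under rotation by [a], recording at each time
    the half of the circle in which the point lies.  The probability that [P_a]
    gives to a cylinder depends continuously on [a].  If the orbit of [0] under
    the rotation is dense, [P_a] is ergodic by the Lebesgue density theorem: an
    invariant set and its complement cannot both have density points, since the
    rotation moves one density point close to the other.  If [a = p/q] with [q]
    odd, [P_a] is not ergodic: the number of visits to a half circle during one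
    period is invariant, and the symmetry [x |-> x + 1/2] of the circle
    exchanges the points for which it is less than [q/2] with the other ones.

    Such fractions are dense.  Near each of them, [P_a] leaves a finite cover of
    any given compact class of ergodic measures; hence, for every machine, the
    parameters avoiding all the classes which it describes contain a dense open
    set.  By Baire's theorem some parameter with dense orbit avoids them all. *)

Require Import Defs.
From HB Require Import structures.
From mathcomp Require Import all_boot all_order all_algebra.
From mathcomp Require Import all_classical all_reals all_analysis.
From mathcomp Require Import measurable_realfun zify lra.

Set Implicit Arguments.
Unset Strict Implicit.
Unset Printing Implicit Defensive.

Import Order.TTheory GRing.Theory Num.Theory.
Import numFieldNormedType.Exports.

Local Open Scope classical_set_scope.
Local Open Scope ring_scope.

(** * Cylinders, measurability and the determination of measures by cylinders *)

Lemma coordinate_open (n : nat) (b : bool) :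
  @open cantor_space [set w : cantor_space | w n = b].
Proof.
have cn : continuous (fun w : cantor_space => w n).
  exact: (@proj_continuous nat (fun=> bool) n).
by apply: ((continuousP _).1 cn [set b]); exact: discrete_open.
Qed.

Lemma measurable_coordinate (n : nat) (b : bool) :
  measurable [set w : Omega | w n = b].
Proof. by apply: sub_sigma_algebra; exact: coordinate_open. Qed.

Lemma measurable_cylinder (y : seq bool) : measurable (cylinder y).
Proof.
rewrite (_ : cylinder y =
    \bigcap_(i in `I_(size y)) [set w : Omega | w i = nth false y i]).
  apply: fin_bigcap_measurable => // i _; exact: measurable_coordinate.
by apply/seteqP; split=> w h i /h.
Qed.

(** Otherwise each prefix of [w] extends to a sequence outside [O]; these sequences converge
    pointwise to [w], so they eventually enter [O]. *)
Lemma open_cylinder_sub (O : set Omega) (w : Omega) :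
  @open cantor_space O -> O w -> exists n, cylinder (mkseq w n) `<=` O.
Proof.
move=> oO Ow; apply: contrapT => noN.
have /choice[v vP] n : exists v, cylinder (mkseq w n) v /\ ~ O v.
  apply: contrapT => nv; apply: noN; exists n => v cv.
  by apply: contrapT => nOv; apply: nv; exists v.
have vw : v @ \oo --> (w : cantor_space).
  apply/(@pointwise_cvgP nat bool (v @ \oo) w) => t.
  apply: (@cvg_near_cst _ bool).
  suff : \forall n \near \oo, v n t = w t by [].
  near=> n.
  have tn : (t < n)%N by near: n; exact: nbhs_infty_gt.
  by have [+ _] := vP n; move=> /(_ t); rewrite size_mkseq nth_mkseq//; exact.
have [n _ /(_ n (leqnn n)) Ovn] : \forall n \near \oo, O (v n).
  by apply: vw; exact: open_nbhs_nbhs.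
by have [] := vP n.
Unshelve. all: by end_near. Qed.

Lemma open_bigcup_cylinder (O : set Omega) : @open cantor_space O ->
  O = \bigcup_(y in [set y | cylinder y `<=` O]) cylinder y.
Proof.
move=> oO; apply/seteqP; split=> [w Ow|w [y yO /yO]//].
have [n nO] := open_cylinder_sub oO Ow; exists (mkseq w n) => //.
by move=> i; rewrite size_mkseq => ni; rewrite nth_mkseq.
Qed.

(** There are only countably many words, so every open set is a countable union of cylinders. *)
Lemma measurable_Omega_cylinder :
  @measurable _ Omega = <<s [set A | A = set0 \/ exists y, A = cylinder y] >>.
Proof.
apply/seteqP; split; last first.
  apply: smallest_sub; first exact: sigma_algebra_measurable.
  move=> A [->|[y ->]]; [exact: measurable0|exact: measurable_cylinder].
apply: smallest_sub; first exact: smallest_sigma_algebra.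
move=> O /open_bigcup_cylinder ->.
rewrite bigcup_mkcond.
apply: (@countable_bigcupT_measurable _ (g_sigma_algebraType _)) => // y.
by case: ifP => // _; apply: sub_sigma_algebra; right; exists y.
Qed.

(** Two cylinders are disjoint or nested. Together with the empty set they thus form a pi-system, on
    which a probability measure is determined. *)
Lemma cylinderI_closed :
  setI_closed [set A | A = set0 \/ exists y, A = cylinder y].
Proof.
have sub y z : (size y <= size z)%N ->
    cylinder y `&` cylinder z = set0 \/ cylinder y `&` cylinder z = cylinder z.
  move=> yz; have [h|h] := pselect (cylinder y `&` cylinder z = set0).
    by left.
  right; apply/setIidr => v zv i iy.
  move/eqP/set0P : h => [w [yw zw]].
  by rewrite -yw// zw ?zv//; exact: leq_trans yz.
move=> A B [->|[y ->]] [->|[z ->]]; rewrite ?set0I ?setI0; try by left.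
have [yz|/ltnW zy] := leqP (size y) (size z).
  by case: (sub _ _ yz) => ->; [left|right; exists z].
by rewrite setIC; case: (sub _ _ zy) => ->; [left|right; exists y].
Qed.

Lemma probability_eq_cylinder (R : realType) (P Q : probability Omega R) :
  (forall y, P (cylinder y) = Q (cylinder y)) ->
  forall A, measurable A -> P A = Q A.
Proof.
move=> PQ; apply: (measure_unique _ (fun=> cylinder [::])
  measurable_Omega_cylinder cylinderI_closed).
- by move=> _; right; exists [::].
- by apply/seteqP; split=> // w _; exists 0%N.
- by move=> A [->|[y ->]]; [rewrite !measure0|exact: PQ].
- by move=> _; rewrite ltey_eq fin_num_measure//; exact: measurable_cylinder.
Qed.

Lemma measurable_fun_Omega (d : measure_display) (T : measurableType d)
    (f : T -> Omega) :
  (forall n, measurable_fun setT (fun x => f x n)) -> measurable_fun setT f.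
Proof.
move=> mf; apply: (@measurability _ _ _ _ _ _
  [set A | A = set0 \/ exists y, A = cylinder y]).
  exact: measurable_Omega_cylinder.
move=> _ [_ [->|[y ->]] <-]; rewrite setTI ?preimage_set0//.
rewrite (_ : _ @^-1` _ =
    \bigcap_(i in `I_(size y)) ((fun x => f x i) @^-1` [set nth false y i])).
  apply: fin_bigcap_measurable => // i _.
  by rewrite -[X in measurable X]setTI; exact: mf.
by apply/seteqP; split=> w h i /h.
Qed.

Lemma measurable_shift : measurable_fun setT Defs.shift.
Proof.
apply: measurable_fun_Omega => n; apply: (@measurable_fun_bool _ _ _ _ true).
by rewrite setTI; exact: (measurable_coordinate n.+1 true).
Qed.

(** Used in contrapositive form: a non-ergodic measure differs from each ergodic one on some
    cylinder, hence can be separated from it by a basic set. *)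
Lemma ergodic_eq_cylinder (R : realType) (P Q : probability Omega R) :
  (forall y, P (cylinder y) = Q (cylinder y)) -> ergodic Q -> ergodic P.
Proof.
move=> /probability_eq_cylinder PQ [sQ eQ].
have mshift A : measurable A -> measurable (Defs.shift @^-1` A).
  by rewrite -[X in _ -> measurable X]setTI; exact: measurable_shift.
split=> A mA; first by rewrite !PQ ?sQ//; exact: mshift.
by rewrite PQ//; exact: eQ.
Qed.


(** * Rotations of the circle, itineraries and their laws *)

Section rotation.
Variable R : realType.
Local Notation mu := (@lebesgue_measure R).

Lemma lebesgue_measure_translate (E : set R) (t : R) : measurable E ->
  mu [set x | E (x + t)] = mu E.
Proof.
move=> mE; have mt : @measurable_fun _ _ (measurableTypeR R) (measurableTypeR R)
    setT (fun x : R => x + t).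
  by apply: measurable_funD => //; exact: measurable_cst.
pose f := @mfun_Sub _ _ (measurableTypeR R) (measurableTypeR R) _ (mem_set mt).
apply/esym; apply: (@lebesgue_measure_unique R (pushforward mu f)) => //.
move=> _ [[a b]] _ <-.
transitivity (mu `](a - t), (b - t)]).
  rewrite !lebesgue_measure_itv/= !lte_fin ltrD2r.
  by case: ifP => // _; rewrite -!EFinD opprB addrA subrK.
congr (mu _); apply/seteqP.
by split=> x /=; rewrite !in_itv/= ltrBlDr lerBrDr.
Qed.

Lemma measurable_translate (E : set R) (t : R) : measurable E ->
  measurable [set x | E (x + t)].
Proof.
move=> mE; rewrite -[X in measurable X]setTI.
have mt : measurable_fun setT (fun x : R => x + t).
  by apply: measurable_funD => //; exact: measurable_cst.
exact: mt.
Qed.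

(** Subsets of the circle R/Z are represented by periodic subsets of the line, and measured on the
    fundamental domain [arc]. *)
Definition periodic1 (E : set R) := forall x, E (x + 1) <-> E x.

Lemma periodic1_int (E : set R) (m : int) (x : R) :
  periodic1 E -> E (x + m%:~R) <-> E x.
Proof.
move=> pE; have pn n y : E (y + n%:R) <-> E y.
  elim: n => [|n IH]; first by rewrite addr0.
  by rewrite -natr1 addrA pE.
case: m => n; first exact: pn.
by rewrite NegzE mulrNz -[in X in _ <-> X](subrK n.+1%:R x) pn.
Qed.

Definition arc : set R := `[0%R, 1%R[%classic.

Lemma measurable_arc : measurable arc. Proof. exact: measurable_itv. Qed.

Lemma lebesgue_measure_arc : mu arc = 1%E.
Proof. by rewrite lebesgue_measure_itv/= lte_fin ltr01 sube0. Qed.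

(** Once [t] is reduced modulo 1, cutting the arc at [t] gives two pieces, whose preimages under the
    rotation are ordinary translates, by [t] and by [t - 1]. *)
Lemma periodic_rotate (E : set R) (t : R) : measurable E -> periodic1 E ->
  mu ([set x | E (x + t)] `&` arc) = mu (E `&` arc).
Proof.
move=> mE pE.
wlog t01 : t / 0 <= t < 1.
  move=> /(_ (t - (Num.floor t)%:~R)) <-; last first.
    have := floor_le t; have := floorD1_gt t; rewrite intrD; lra.
  congr (mu (_ `&` arc)); apply/seteqP; split=> x /=.
  - by rewrite addrA -mulrNz => ?; apply/periodic1_int.
  - by rewrite addrA -mulrNz => /periodic1_int; exact.
have mI (i : interval R) : measurable (E `&` [set` i]).
  by apply: measurableI => //; exact: measurable_itv.
have mtI (i : interval R) s : measurable ([set x | E (x + s)] `&` [set` i]).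
  by apply: measurableI; [exact: measurable_translate|exact: measurable_itv].
have -> : E `&` arc = (E `&` `[t, 1[) `|` (E `&` `[0, t[).
  rewrite -setIUr /arc; congr (E `&` _); apply/seteqP.
  split=> x /=; rewrite !in_itv/=.
    by have [] := leP t x => /= + /andP[]; [left|right]; lra.
  by case; lra.
have -> : [set x | E (x + t)] `&` arc = ([set x | E (x + t)] `&` `[0, 1 - t[)
    `|` ([set x | E (x + (t - 1))] `&` `[1 - t, 1[).
  apply/seteqP; split=> x; rewrite /arc/= !in_itv/=.
    move=> [Ex x01]; have [h|h] := ltP x (1 - t).
      by left; split=> //; lra.
    right; split; last by lra.
    by apply: (pE _).1; rewrite addrA subrK.
  move=> [[Ex h]|[Ex h]]; split => //; try lra.
  by have := (pE _).2 Ex; rewrite addrA subrK.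
have disj (A B : set R) (u v w : R) :
    (A `&` `[u, v[) `&` (B `&` `[v, w[) = set0.
  by apply/seteqP; split=> x //= -[[_ +] [_ +]]; rewrite !in_itv/=; lra.
rewrite measureU ?disj; [|exact: mtI|exact: mtI|by []].
rewrite setUC measureU ?disj; [|exact: mI|exact: mI|by []].
rewrite addeC.
congr (_ + _)%E.
  rewrite -[RHS](@lebesgue_measure_translate _ (t - 1)); last exact: mI.
  congr (mu _); apply/seteqP.
  by split=> x /= [Ex]; rewrite !in_itv/= => h; split=> //; lra.
rewrite -[RHS](@lebesgue_measure_translate _ t); last exact: mI.
congr (mu _); apply/seteqP.
by split=> x /= [Ex]; rewrite !in_itv/= => h; split=> //; lra.
Qed.

(* [true] on the half circle [1/2, 1) and [false] on [0, 1/2), modulo 1. *)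
Definition side (x : R) : bool := odd `|Num.floor (x *+ 2)|%N.

(** A half turn adds 1 to the floor of [x *+ 2] and so changes its parity. This is the symmetry
    behind the failure of ergodicity at odd denominators. *)
Lemma side_half (x : R) : side (x + 2^-1) = ~~ side x.
Proof.
rewrite /side mulrnDl -[2^-1 *+ 2]mulr_natr mulVf ?pnatr_eq0//.
rewrite floorDrz// floor1; case: (Num.floor _) => n.
  by rewrite -PoszD addn1.
have -> : Negz n + 1 = - n%:Z by lia.
by rewrite NegzE !abszN !absz_nat/= negbK.
Qed.

Lemma side_period1 (x : R) : side (x + 1) = side x.
Proof. by rewrite {1}[1]splitr !mul1r addrA !side_half negbK. Qed.

Lemma side_int (x : R) (m : int) : side (x + m%:~R) = side x.
Proof.
have [|] := @periodic1_int [set x | side x] m x.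
  by move=> y /=; rewrite side_period1.
by move=> /= h1 h2; apply/idP/idP.
Qed.

Lemma measurable_side : measurable_fun setT side.
Proof.
apply: (@measurable_fun_bool _ _ _ _ true); rewrite setTI.
rewrite (_ : _ @^-1` _ = \bigcup_(m in [set m : int | odd `|m|])
    [set x | m%:~R <= x *+ 2 < m%:~R + 1]).
  rewrite bigcup_mkcond; apply: countable_bigcupT_measurable => // m.
  case: ifP => // _.
  rewrite (_ : [set _ | _] = `[m%:~R / 2, (m%:~R + 1) / 2[%classic).
    exact: measurable_itv.
  by apply/seteqP; split=> x /=; rewrite in_itv/= -mulr_natr; lra.
apply/seteqP; split=> x /=; rewrite /side.
  move=> o; exists (Num.floor (x *+ 2)) => //=.
  have := floor_le (x *+ 2); have := floorD1_gt (x *+ 2); rewrite intrD; lra.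
by move=> [m om] /= h; rewrite (@floor_def _ _ m)// intrD.
Qed.

Definition itinerary (a x : R) : Omega := fun n => side (x + n%:R * a).

Lemma measurable_itinerary (a : R) : measurable_fun setT (itinerary a).
Proof.
apply: measurable_fun_Omega => n.
apply: (measurableT_comp measurable_side).
by apply: measurable_funD => //; exact: measurable_cst.
Qed.

Lemma itinerary_shift (a x : R) :
  itinerary a (x + a) = Defs.shift (itinerary a x).
Proof.
apply/funext => n; rewrite /itinerary /Defs.shift -natr1 mulrDl mul1r.
by rewrite -addrA [a + _]addrC.
Qed.

Lemma itinerary_period1 (a x : R) : itinerary a (x + 1) = itinerary a x.
Proof. by apply/funext => n; rewrite /itinerary addrAC side_period1. Qed.

Lemma itinerary_periodic (a : R) (A : set Omega) :
  periodic1 (itinerary a @^-1` A).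
Proof. by move=> x /=; rewrite itinerary_period1. Qed.

Definition arc_law : set (measurableTypeR R) -> \bar R :=
  mrestr mu measurable_arc.

HB.instance Definition _ := Measure.on arc_law.

Lemma arc_law_setT : arc_law setT = 1%E.
Proof. by rewrite /arc_law /mrestr setTI lebesgue_measure_arc. Qed.

HB.instance Definition _ :=
  Measure_isProbability.Build _ _ _ arc_law arc_law_setT.

Definition rotation_law (a : R) : probability Omega R :=
  distribution arc_law
    (@mfun_Sub _ _ (measurableTypeR R) Omega _
      (mem_set (measurable_itinerary a))).

Lemma rotation_lawE (a : R) (A : set Omega) :
  rotation_law a A = mu (itinerary a @^-1` A `&` arc).
Proof. by []. Qed.

Lemma measurable_itinerary_preimage (a : R) (A : set Omega) :
  measurable A -> measurable (itinerary a @^-1` A).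
Proof.
by move=> mA; rewrite -[X in measurable X]setTI; exact: measurable_itinerary.
Qed.

Lemma rotation_law_stationary (a : R) : stationary (rotation_law a).
Proof.
move=> A mA; rewrite !rotation_lawE.
rewrite -(periodic_rotate a _ (@itinerary_periodic a A)).
  by congr (mu (_ `&` _)); apply/seteqP; split=> x; rewrite /= itinerary_shift.
exact: measurable_itinerary_preimage.
Qed.

End rotation.
Arguments arc {R}.

(** * Continuity of cylinder probabilities in the rotation angle *)

Section rotation_properties.
Variable R : realType.
Local Notation mu := (@lebesgue_measure R).

Lemma sideE (x : R) : 0 <= x < 1 -> side x = (2^-1 <= x).
Proof.
move=> x01; rewrite /side; have [h|h] := leP 2^-1 x.
  by rewrite (@floor_def _ _ 1)//= -mulr_natr; lra.
by rewrite (@floor_def _ _ 0)//= -mulr_natr; lra.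
Qed.

Lemma measurable_side_neq (s t : R) :
  measurable [set x | side (x + s) != side (x + t)].
Proof.
have mc u : measurable_fun setT (fun x : R => side (x + u)).
  apply: (measurableT_comp (@measurable_side R)).
  by apply: measurable_funD => //; exact: measurable_cst.
rewrite (_ : [set _ | _] = \bigcup_(b in [set: bool])
    ((fun x : R => side (x + s)) @^-1` [set b] `&`
     (fun x : R => side (x + t)) @^-1` [set ~~ b])).
  apply: countable_bigcupT_measurable => // b; apply: measurableI.
    by rewrite -[X in measurable X]setTI; exact: mc.
  by rewrite -[X in measurable X]setTI; exact: mc.
apply/seteqP; split=> x /=.
  move=> h; exists (side (x + s)) => //; split=> //=.
  by move: h; do 2 case: side.
by move=> [b _ [/= -> ->]]; case: b.
Qed.

Lemma side_neq_periodic (s t : R) :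
  periodic1 [set x | side (x + s) != side (x + t)].
Proof.
by move=> x /=; rewrite [x + 1 + s]addrAC [x + 1 + t]addrAC !side_period1.
Qed.

(** After a rotation by [- t], the sides of [x + d] and [x] differ only if a boundary point, 1/2 or
    1, is crossed between them. This confines [x] to two intervals of length [d]. *)
Lemma lebesgue_measure_side_neq (s t : R) : `|s - t| <= 2^-1 ->
  (mu ([set x | side (x + s) != side (x + t)] `&` arc) <=
    (2 * `|s - t|)%:E)%E.
Proof.
move=> st; wlog st0 : s t st / t <= s.
  move=> H; have [|/ltW] := leP t s; first exact: H.
  move=> /H; rewrite distrC => /(_ st); apply: le_trans.
  rewrite le_eqVlt; apply/orP; left; apply/eqP; congr (mu (_ `&` _)).
  by apply/seteqP; split=> x /=; rewrite eq_sym.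
rewrite -(@periodic_rotate _ _ (- t)); last 2 first.
- exact: measurable_side_neq.
- exact: side_neq_periodic.
rewrite ger0_norm ?subr_ge0// in st *.
set d := s - t in st *; have d0 : 0 <= d by rewrite subr_ge0.
have mI (i : interval R) : measurable [set` i] by exact: measurable_itv.
have -> : [set x | [set x | side (x + s) != side (x + t)] (x - t)] =
    [set x | side (x + d) != side x].
  by apply/seteqP; split=> x /=; rewrite subrK addrAC -addrA.
pose I1 : set R := `[2^-1 - d, 2^-1[%classic.
pose I2 : set R := `[1 - d, 1[%classic.
apply: (@le_trans _ _ (mu (I1 `|` I2))).
  apply: le_measure; rewrite ?inE.
  - apply: measurableI; last exact: measurable_arc.
    by have := measurable_side_neq d 0; under eq_set do rewrite addr0.
  - by apply: measurableU; exact: mI.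
  move=> x [/= xd]; rewrite /I1 /I2 /arc/= !in_itv/= => x01.
  have [x1|x1] := ltP (x + d) 1.
    move: xd; rewrite !sideE//; last lra.
    have [h1|h1] := leP 2^-1 (x + d); have [h2|h2] := leP 2^-1 x => //= _.
      by left; lra.
    by exfalso; lra.
  right; lra.
apply: (@le_trans _ _ (mu I1 + mu I2)%E).
  by apply: measureU2; exact: mI.
rewrite !lebesgue_measure_itv/= !lte_fin.
by do 2 case: ifP => _; rewrite ?adde0 ?add0e -?EFinD lee_fin; lra.
Qed.

Definition differ (a b : R) (n : nat) : set R :=
  [set x | exists2 i, (i < n)%N & side (x + i%:R * a) != side (x + i%:R * b)].

Lemma differS (a b : R) (n : nat) : differ a b n.+1 =
  differ a b n `|` [set x | side (x + n%:R * a) != side (x + n%:R * b)].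
Proof.
apply/seteqP; split=> x /=.
  move=> [i]; rewrite ltnS leq_eqVlt => /orP[/eqP -> ?|ni ?]; first by right.
  by left; exists i.
by move=> [[i ni ?]|?]; [exists i => //; exact: ltnW|exists n].
Qed.

Lemma measurable_differ (a b : R) (n : nat) : measurable (differ a b n).
Proof.
elim: n => [|n IH].
  by rewrite (_ : differ a b 0 = set0)//; apply/seteqP; split=> x // [].
by rewrite differS; apply: measurableU => //; exact: measurable_side_neq.
Qed.

(** A union bound over the times below [k]. The horizon [n] is kept apart from [k] so that the bound
    at each single time stays fixed in the induction. *)
Lemma lebesgue_measure_differ (a b : R) (n k : nat) : n%:R * `|a - b| <= 2^-1 ->
  (k <= n)%N ->
  (mu (differ a b k `&` arc) <= (k%:R * (2 * (n%:R * `|a - b|)))%:E)%E.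
Proof.
move=> nab; elim: k => [_|k IH kn].
  rewrite (_ : differ a b 0 = set0) ?set0I ?measure0 ?mul0r//.
  by apply/seteqP; split=> x // [].
have kab : `|k%:R * a - k%:R * b| <= n%:R * `|a - b|.
  rewrite -mulrBr normrM ger0_norm// ler_wpM2r// ler_nat; exact: ltnW.
rewrite differS setIUl; apply: (le_trans (measureU2 _ _ _)).
- by apply: measurableI; [exact: measurable_differ|exact: measurable_arc].
- by apply: measurableI; [exact: measurable_side_neq|exact: measurable_arc].
rewrite -natr1 mulrDl mul1r EFinD; apply: leeD; first exact/IH/ltnW.
apply: (le_trans (lebesgue_measure_side_neq _)); first exact: le_trans nab.
by rewrite lee_fin ler_wpM2l.
Qed.

(** A point whose itinerary under [a] begins with [y] either has such an itinerary under [b] as well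
    or lies in the small set [differ a b (size y)]. *)
Lemma rotation_law_cylinder_le (a b : R) (y : seq bool) :
  (size y)%:R * `|a - b| <= 2^-1 ->
  (rotation_law a (cylinder y) <= rotation_law b (cylinder y) +
    ((size y)%:R * (2 * ((size y)%:R * `|a - b|)))%:E)%E.
Proof.
move=> yab; rewrite !rotation_lawE.
have mC c : measurable (itinerary c @^-1` cylinder y `&` arc).
  apply: measurableI; last exact: measurable_arc.
  by apply: measurable_itinerary_preimage; exact: measurable_cylinder.
have mD : measurable (differ a b (size y) `&` arc).
  by apply: measurableI; [exact: measurable_differ|exact: measurable_arc].
apply: (@le_trans _ _ (mu ((itinerary b @^-1` cylinder y `&` arc) `|`
                           (differ a b (size y) `&` arc)))).
  apply: le_measure; rewrite ?inE; [exact: mC| |].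
    by apply: measurableU; [exact: mC|exact: mD].
  move=> x [yx x01]; have [dx|dx] := pselect (differ a b (size y) x).
    by right.
  left; split=> // i iy; rewrite -yx//; apply/eqP.
  by rewrite eq_sym; apply: contrapT => /negP h; apply: dx; exists i.
apply: (le_trans (measureU2 _ _ _)); [exact: mC|exact: mD|].
by apply: leeD2l; exact: lebesgue_measure_differ.
Qed.

Lemma rotation_law_cylinder_near (b e : R) (y : seq bool) : 0 < e ->
  \forall a \near b,
    (rotation_law a (cylinder y) < rotation_law b (cylinder y) + e%:E)%E /\
    (rotation_law b (cylinder y) < rotation_law a (cylinder y) + e%:E)%E.
Proof.
move=> e0; pose n := (size y)%:R : R.
(* The first term meets the hypothesis of the previous bound, the second makes its error smaller
   than [e]; adding 1 keeps the denominators positive for the empty word. *)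
pose d := Num.min (2^-1 / (n + 1)) (e / (n * (2 * n) + 1)).
have n0 : 0 <= n by rewrite ler0n.
have nn0 : 0 <= n * (2 * n) by rewrite !mulr_ge0.
have d0 : 0 < d by rewrite lt_min !divr_gt0// ltr_wpDl.
near=> a; have ab : `|b - a| < d by near: a; exact: nbhsx_ballx.
have : `|b - a| < 2^-1 / (n + 1).
  by apply: lt_le_trans ab _; rewrite ge_min lexx.
have : `|b - a| < e / (n * (2 * n) + 1).
  by apply: lt_le_trans ab _; rewrite ge_min lexx orbT.
rewrite !ltr_pdivlMr ?ltr_wpDl// => h1 h2.
have ab0 : 0 <= `|b - a| by [].
have h : n * `|b - a| <= 2^-1 by nra.
have h' : n * (2 * (n * `|b - a|)) < e by nra.
have fP c : (rotation_law c (cylinder y)) \is a fin_num.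
  by apply: fin_num_measure; exact: measurable_cylinder.
split.
  rewrite distrC in h h'; apply: (le_lt_trans (rotation_law_cylinder_le h)).
  by rewrite lteD2lE ?fP// lte_fin.
apply: (le_lt_trans (rotation_law_cylinder_le h)).
by rewrite lteD2lE ?fP// lte_fin.
Unshelve. all: by end_near. Qed.

End rotation_properties.

(** * Ergodicity for dense orbits and its failure at fractions with odd denominator *)

Section rotation_ergodicity.
Variable R : realType.
Local Notation mu := (@lebesgue_measure R).

(** By the Lebesgue density theorem almost every point of [B] has density 1. In small balls the
    density exceeds 3/4, and a ball of radius [r] has length [2 * r]. *)
Lemma density_point (B D : set R) : measurable B -> measurable D ->
  mu (B `&` D) != 0%E -> exists2 x, B x &
    \forall r \near 0^'+, (((3 / 2) * r)%:E < mu (B `&` ball x r))%E.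
Proof.
move=> mB mD BD0; apply: contrapT => nx; move/eqP: BD0; apply.
have [N [mN N0 hN]] := lebesgue_density mB.
apply/eqP; rewrite eq_le measure_ge0 andbT -N0.
apply: le_measure; rewrite ?inE; [exact: measurableI|exact: mN|].
move=> x [Bx Dx]; apply: hN => /= cx; apply: nx; exists x => //.
rewrite indicE mem_set//= in cx.
have h : \forall r \near 0^'+,
    ((3 / 4)%:E < mu (B `&` ball x r) * (mu (ball x r))^-1)%E.
  apply: (cx [set y | (3 / 4)%:E < y]%E); apply: open_ereal_gt'.
  by rewrite lte_fin; lra.
near=> r.
have r0 : 0 < r by [].
have : ((3 / 4)%:E < mu (B `&` ball x r) * (mu (ball x r))^-1)%E.
  by near: r.
rewrite lebesgue_measure_ball ?(ltW r0)//.
have r20 : 0 < r *+ 2 by rewrite mulrn_wgt0.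
rewrite inver gt_eqF// lte_pdivlMr//; apply: le_lt_trans.
by rewrite -EFinM lee_fin -mulr_natr; lra.
Unshelve. all: by end_near. Qed.

(** Density of the forward orbit of 0 in R/Z, lifted to the line by the integer [m]. *)
Definition dense_orbit (a : R) := forall t r : R, 0 < r ->
  exists (n : nat) (m : int), `|n%:R * a + m%:~R - t| < r.

(** Otherwise [B] and its complement have density points [b] and [c]. A translation along the orbit
    maps [B] into itself and brings [b] close to [c], where there is no room for large parts of both
    sets. *)
Lemma dense_orbit_zero_one (a : R) (B : set R) : dense_orbit a ->
  measurable B -> periodic1 B -> (forall x, B x -> B (x + a)) ->
  mu (B `&` arc) = 0%E \/ mu (~` B `&` arc) = 0%E.
Proof.
move=> da mB pB Ba; apply: contrapT => /not_orP[/eqP B0 /eqP C0].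
have mC : measurable (~` B) by exact: measurableC.
have [b Bb nb] := density_point mB (@measurable_arc R) B0.
have [c Cc nc] := density_point mC (@measurable_arc R) C0.
have [r [r0 rb rc]] : exists r : R, [/\ 0 < r,
    (((3 / 2) * r)%:E < mu (B `&` ball b r))%E &
    (((3 / 2) * r)%:E < mu (~` B `&` ball c r))%E].
  have : \forall r \near 0^'+, [/\ 0 < r,
    (((3 / 2) * r)%:E < mu (B `&` ball b r))%E &
    (((3 / 2) * r)%:E < mu (~` B `&` ball c r))%E].
    by near=> r; split=> //; near: r.
  by move=> /filter_ex.
(* The tolerance [r / 4] keeps the moved ball inside the ball of radius [5 / 4 * r] about [c]. The
   length [5 / 2 * r] of the latter is less than [3 * r], which the two disjoint pieces together
   exceed. *)
have [|n [m nmr]] := da (c - b) (r / 4); first by rewrite divr_gt0.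
pose s := n%:R * a + m%:~R.
have Bs x : B x -> B (x + s).
  move=> Bx; rewrite /s addrA; apply/periodic1_int => //.
  elim: n {nmr s} => [|n IH]; first by rewrite mul0r addr0.
  by rewrite -natr1 mulrDl mul1r addrA; exact: Ba.
have mb (x e : R) : measurable (ball x e) by exact: measurable_ball.
have mBb : measurable (B `&` ball b r) by exact: measurableI.
have mCc : measurable (~` B `&` ball c r) by exact: measurableI.
pose B' := [set x | (B `&` ball b r) (x + (- s))].
have mB' : measurable B' by exact: measurable_translate.
have B'E : mu B' = mu (B `&` ball b r) by exact: lebesgue_measure_translate.
have disj : B' `&` (~` B `&` ball c r) = set0.
  apply/seteqP; split=> x //= [[/Bs + _] [+ _]].
  by rewrite subrK.
have sub : B' `|` (~` B `&` ball c r) `<=` ball c ((5 / 4) * r).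
  move=> x [[_]|[_]]; rewrite /ball/=; last by lra.
  move: nmr; rewrite -/s !ltr_norml; lra.
have : (mu (B' `|` (~` B `&` ball c r)) <= mu (ball c ((5 / 4) * r)))%E.
  apply: le_measure; rewrite ?inE; [|exact: mb|exact: sub].
  by apply: measurableU; [exact: mB'|exact: mCc].
have -> : mu (B' `|` (~` B `&` ball c r)) =
    (mu (B `&` ball b r) + mu (~` B `&` ball c r))%E.
  by rewrite -B'E; exact: measureU.
rewrite lebesgue_measure_ball; last by lra.
apply/negP; rewrite -ltNge.
apply: lt_trans (lteD rb rc).
by rewrite -EFinD lte_fin -mulr_natr; lra.
Unshelve. all: by end_near. Qed.

Lemma rotation_law_ergodic (a : R) : dense_orbit a -> ergodic (rotation_law a).
Proof.
move=> da; split; first exact: rotation_law_stationary.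
move=> A mA iA; have mE := measurable_itinerary_preimage a mA.
have iE x : (itinerary a @^-1` A) x -> (itinerary a @^-1` A) (x + a).
  by move=> Ax; rewrite /= itinerary_shift; apply: iA; exists (itinerary a x).
have [h|h] := dense_orbit_zero_one da mE (@itinerary_periodic _ a A) iE.
  by left.
right; have mcA : measurable (~` A) by exact: measurableC.
have : rotation_law a (~` A) = 0%E by rewrite rotation_lawE.
rewrite probability_setC//.
have := fin_num_measure (rotation_law a) A mA.
case: (rotation_law a A) => // p _; rewrite -EFinB => -[/eqP].
by rewrite subr_eq0 => /eqP <-.
Qed.

Lemma rotation_law_odd_not_ergodic (p : int) (q : nat) :
  odd q -> ~ ergodic (rotation_law (p%:~R / q%:R : R)).
Proof.
move=> oq [_ erg]; set a := p%:~R / q%:R in erg.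
have q0 : (q%:R : R) != 0 by rewrite pnatr_eq0; case: q oq {erg a}.
pose ones (w : Omega) := (\sum_(i < q) w i)%N.
(* Periodicity is made part of [A] so that [A] is invariant among all sequences, not only among
   itineraries. *)
pose A := (\bigcap_n [set w : Omega | w (n + q)%N = w n]) `&`
  [set w : Omega | ((ones w).*2 < q)%N].
have mA : measurable A.
  apply: measurableI.
    apply: bigcapT_measurable => n.
    rewrite (_ : [set _ | _] = \bigcup_(b in [set: bool])
        ([set w : Omega | w (n + q)%N = b] `&` [set w : Omega | w n = b])).
      apply: countable_bigcupT_measurable => // b.
      by apply: measurableI; exact: measurable_coordinate.
    apply/seteqP; split=> w /= => [h|[b _ [-> ->]]//].
    by exists (w n).
  rewrite (_ : [set _ | _] = \bigcup_(y in [set y : q.-tuple bool |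
      ((\sum_(i < q) tnth y i).*2 < q)%N]) cylinder y).
    rewrite bigcup_mkcond; apply: countable_bigcupT_measurable => // y.
    by case: ifP => // _; exact: measurable_cylinder.
  have sz (y : q.-tuple bool) w : cylinder y w ->
      (\sum_(i < q) tnth y i = ones w)%N.
    move=> yw; apply: eq_bigr => i _; rewrite yw ?size_tuple//.
    by rewrite (tnth_nth false).
  apply/seteqP; split=> w /=; last by move=> [y yq /sz <-].
  move=> h; exists [tuple w i | i < q].
    by rewrite /= (eq_bigr (fun i : 'I_q => nat_of_bool (w i)))// => i _;
      rewrite tnth_mktuple.
  move=> i; rewrite size_tuple => iq.
  by rewrite -[i]/(nat_of_ord (Ordinal iq)) -tnth_nth tnth_mktuple.
have iA : Defs.invariant A.
  move=> _ [w [wq w1] <-]; split=> [n _|]; first exact: (wq n.+1).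
  (* The shift drops the symbol at 0 and gains the one at [q], which is equal to it. *)
  rewrite /= (_ : ones _ = ones w)// /ones /Defs.shift.
  case: q {erg oq mA q0 a A ones w1} wq => [|q] wq; first by rewrite !big_ord0.
  rewrite big_ord_recr/= big_ord_recl/= addnC; congr (_ + _)%N.
  by have := wq 0%N I => /= ->.
have AE x : A (itinerary a x) <-> ((ones (itinerary a x)).*2 < q)%N.
  split=> [[]//|h]; split=> // n _ /=.
  rewrite /itinerary natrD mulrDl addrA /a [q%:R * _]mulrC divfK//.
  by rewrite side_int.
have half x : ones (itinerary a (x + 2^-1)) = (q - ones (itinerary a x))%N.
  have : (ones (itinerary a (x + 2^-1)) + ones (itinerary a x) = q)%N.
    rewrite /ones -big_split/= -[RHS]card_ord -sum1_card; apply: eq_bigr => i _.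
    by rewrite /itinerary addrAC side_half; case: side.
  by move=> <-; rewrite addnK.
have ones_le x : (ones (itinerary a x) <= q)%N.
  rewrite -[leqRHS]card_ord -sum1_card; apply: leq_sum => i _.
  by case: (itinerary a x i).
(* A half turn replaces the count by its complement to [q], and [q] being odd excludes a tie. As
   rotations preserve measure, [A] and its complement are equally likely, so neither 0 nor 1 is
   possible. *)
have EC : [set x | (itinerary a @^-1` A) (x + 2^-1)] = ~` (itinerary a @^-1` A).
  apply/seteqP; split=> x; rewrite /setC/= !AE half; have := ones_le x; lia.
have mE := measurable_itinerary_preimage a mA.
have := periodic_rotate 2^-1 mE (@itinerary_periodic _ a A).
rewrite EC -[~` _]/(itinerary a @^-1` (~` A)) -!rotation_lawE.
rewrite probability_setC//.
case: (erg A mA iA) => ->; rewrite -?EFinB.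
  by rewrite subr0 => -[/eqP]; rewrite oner_eq0.
by rewrite subrr => -[/eqP]; rewrite eq_sym oner_eq0.
Qed.

(** For an odd [q] with [1 / q] below [y - x], the first multiple of [1 / q] beyond [x] lies before
    [y]. *)
Lemma odd_fraction_between (x y : R) : x < y ->
  exists (p : int) (q : nat), odd q /\ x < p%:~R / q%:R < y.
Proof.
move=> xy; pose k := Num.trunc (y - x)^-1; pose q := k.*2.+1.
have yx0 : 0 < y - x by rewrite subr_gt0.
have kq : (y - x)^-1 < q%:R.
  apply: (@lt_le_trans _ _ k.+1%:R); first exact: truncnS_gt.
  by rewrite ler_nat ltnS -addnn leq_addr.
have q0 : 0 < q%:R :> R by rewrite ltr0n.
exists (Num.floor (x * q%:R) + 1), q; split; first by rewrite /= odd_double.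
rewrite ltr_pdivlMr// ltr_pdivrMr// floorD1_gt/= intrD.
have := floor_le (x * q%:R).
have : 1 < q%:R * (y - x) by rewrite -ltr_pdivrMr// div1r.
rewrite mulrBr; lra.
Qed.

End rotation_ergodicity.

(** This coding makes instructions, hence machines, a countable type, so that Baire's theorem can
    run through all machines. *)
Definition instr_code (i : instr) : nat + nat * nat :=
  match i with Inc r => inl r | Dec r j => inr (r, j) end.

Definition instr_decode (c : nat + nat * nat) : instr :=
  match c with inl r => Inc r | inr (r, j) => Dec r j end.

Lemma instr_codeK : cancel instr_code instr_decode. Proof. by case. Qed.

HB.instance Definition _ := Countable.copy instr (can_type instr_codeK).

(** * The Baire category argument over rotation angles *)

Section generic_rotation.
Variable R : realType.

(** Rational targets and tolerances [1 / (k + 1)] turn density of the orbit into countably many open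
    conditions on the angle. *)
Definition orbit_near (t : rat) (k : nat) : set R :=
  [set a | exists (n : nat) (m : int),
    `|n%:R * a + m%:~R - ratr t| < k.+1%:R^-1].

Lemma orbit_near_open (t : rat) (k : nat) : open (orbit_near t k).
Proof.
rewrite openE => a [n [m h]]; rewrite /interior/=.
have c : (fun x : R => `|n%:R * x + m%:~R - ratr t|) @ a -->
    `|n%:R * a + m%:~R - ratr t|.
  apply: cvg_norm; apply: cvgB; last exact: cvg_cst.
  apply: cvgD; last exact: cvg_cst.
  by apply: cvgM; [exact: cvg_cst|exact: cvg_id].
have {}c : \forall x \near a, `|n%:R * x + m%:~R - ratr t| < k.+1%:R^-1.
  by apply: (c [set z | z < k.+1%:R^-1]); exact: open_nbhs_nbhs.
by near=> x; exists n, m; near: x.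
Unshelve. all: by end_near. Qed.

(** The angles whose [n]-th multiple equals [t] modulo 1 are spaced by [1 / n], so for [n] above
    [1 / e] one of them lies within [e] of [a0]. *)
Lemma orbit_near_dense (t : rat) (k : nat) : dense (orbit_near t k).
Proof.
move=> O [a0 Oa0] oO.
have /nbhs_ballP[e /= e0 eO] : nbhs a0 O by exact: open_nbhs_nbhs.
pose n := (Num.trunc e^-1).+1.
have n0 : 0 < n%:R :> R by rewrite ltr0n.
have ne : e^-1 < n%:R by exact: truncnS_gt.
pose m := Num.floor (ratr t - n%:R * a0 : R).
exists ((ratr t - m%:~R) / n%:R); split.
  have m1 : m%:~R <= ratr t - n%:R * a0 :> R by exact: floor_le.
  have m2 : ratr t - n%:R * a0 < m%:~R + 1 :> R.
    by rewrite -[1]/(1%:~R) -intrD floorD1_gt.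
  have ne1 : 1 < n%:R * e by rewrite -ltr_pdivrMr// div1r.
  apply: eO; rewrite /ball/= ltr_norml; apply/andP; split.
    by rewrite ltrBrDr -ltrBrDl opprK ltr_pdivrMr// ; nra.
  rewrite ltrBlDr -ltrBlDl ltr_pdivlMr//; nra.
exists n, m; rewrite mulrC divfK ?gt_eqF// subrK subrr normr0 invr_gt0//.
Qed.

Lemma dense_orbitP (a : R) : (forall t k, orbit_near t k a) -> dense_orbit a.
Proof.
move=> h t r r0.
have r20 : 0 < r / 2 by rewrite divr_gt0.
have [|q] := @rat_in_itvoo R t (t + r / 2); first by rewrite ltrDl.
rewrite in_itv/= => tq.
have [n [m nm]] := h q (Num.trunc (r / 2)^-1).
exists n, m; pose k := (Num.trunc (r / 2)^-1).+1.
have kr : (r / 2)^-1 < k%:R by exact: truncnS_gt.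
have k0 : 0 < k%:R :> R by rewrite ltr0n.
have kr2 : k%:R^-1 < r / 2 by rewrite invf_plt ?posrE.
by move: nm; rewrite -/k !ltr_norml; lra.
Qed.

(** Naming the machine allows all classes with the same enumeration to be treated at once, leaving
    only countably many cases. *)
Definition captured_by (M : machine) (C : set (probability Omega R)) : Prop :=
  [/\ compact C, C `<=` [set Q | ergodic Q] &
    pickle @` [set F : seq basic_code | covers F C] =
    [set y | exists x, computes M x y]].

Definition avoiding (M : machine) : set R :=
  [set a | forall C, captured_by M C -> ~ C (rotation_law a)].

Lemma basic_open (b : basic_code) : open (basic (R := R) b).
Proof.
exists [set b] => //; exact: bigcup_set1.
Qed.

(** One condition suffices, with a rational bound strictly between the two probabilities; the other
    bound, 2 or -1, holds for every probability. The distance from [P (cylinder y)] to the rational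
    serves as [e], so measures near [P] on this cylinder are excluded too. *)
Lemma separating_basic (P Q : probability Omega R) (y : seq bool) :
  P (cylinder y) != Q (cylinder y) -> exists b : basic_code, basic b Q /\
  exists2 e : R, 0 < e & forall P' : probability Omega R,
    (P' (cylinder y) < P (cylinder y) + e%:E)%E ->
    (P (cylinder y) < P' (cylinder y) + e%:E)%E -> ~ basic b P'.
Proof.
have fin (P' : probability Omega R) :
    exists2 p, P' (cylinder y) = p%:E & 0 <= p <= 1.
  have my := measurable_cylinder y.
  have fP : P' (cylinder y) \is a fin_num by exact: fin_num_measure.
  exists (fine (P' (cylinder y))); first by rewrite fineK.
  by rewrite -!lee_fin fineK// measure_ge0/= probability_le1.
have [p Pp p01] := fin P; have [q Qq q01] := fin Q.
rewrite Pp Qq eqe neq_lt => /orP[pq|qp].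
  have [r] := rat_in_itvoo pq; rewrite in_itv/= => /andP[pr rq].
  exists [:: (y, r, 2)]; split.
    move=> c; rewrite inE => /eqP -> /=.
    by rewrite Qq !lte_fin rq ratr_nat/=; lra.
  exists (ratr r - p); first by rewrite subr_gt0.
  move=> P' h _ /(_ (y, r, 2)); rewrite inE eqxx => /(_ isT) /= /andP[+ _].
  have [p' Pp' _] := fin P'; move: h; rewrite Pp' -EFinD !lte_fin; lra.
have [r] := rat_in_itvoo qp; rewrite in_itv/= => /andP[qr rp].
exists [:: (y, -1, r)]; split.
  move=> c; rewrite inE => /eqP -> /=; rewrite Qq !lte_fin qr andbT.
  by rewrite rmorphN1; lra.
exists (p - ratr r); first by rewrite subr_gt0.
move=> P' _ h /(_ (y, -1, r)); rewrite inE eqxx => /(_ isT) /= /andP[_].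
have [p' Pp' _] := fin P'; move: h; rewrite Pp' -EFinD !lte_fin; lra.
Qed.

(* Two classes described by the same machine have the same finite covers, so the
   cover obtained for one class by compactness serves for all of them. *)
Lemma near_avoiding (M : machine) (a0 : R) :
  ~ ergodic (rotation_law a0) -> \forall a \near a0, avoiding M a.
Proof.
move=> nerg.
have [[C0 [cC0 eC0 C0M]]|noC] := pselect (exists C, captured_by M C);
  last first.
  by near=> a => C CM; exfalso; apply: noC; exists C.
(* The basic sets missed by the laws of all angles near [a0]. They cover [C0], since the non-ergodic
   law at [a0] differs from each member of [C0] on some cylinder; compactness then leaves finitely
   many. *)
pose D := [set b : basic_code | \forall a \near a0, ~ basic b (rotation_law a)].
have sep : C0 `<=` cover D (@basic R).
  move=> Q C0Q.
  have [y Py] : exists y, rotation_law a0 (cylinder y) != Q (cylinder y).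
    apply: contrapT => nP; apply: nerg; apply: (@ergodic_eq_cylinder _ _ Q).
      by move=> y; apply: contrapT => /eqP h; apply: nP; exists y.
    exact: eC0.
  have [b [bQ [e e0 he]]] := separating_basic Py.
  exists b => //; rewrite /D/=.
  have := rotation_law_cylinder_near a0 y e0.
  by apply: filterS => a [h1 h2]; exact: he.
move: (cC0); rewrite compact_cover => /(_ _ D (@basic R)).
move=> /(_ (fun b _ => basic_open b) sep)[F FD CF].
pose s : seq basic_code := finmap.enum_fset F.
have sC0 : covers s C0 by exact: CF.
have near_s : \forall a \near a0,
    forall b, b \in s -> ~ basic b (rotation_law a).
  have : {subset s <= D} by exact: FD.
  elim: s {sC0} => [_|b s IH bsD]; first by near=> a.
  have Db : D b by apply: set_mem; apply: bsD; rewrite mem_head.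
  have {}IH := IH (fun x xs => bsD x (@mem_behead _ (b :: s) _ xs)).
  move: Db; rewrite /D/= => Db; near=> a => c; rewrite inE => /predU1P[->|cs].
    by near: a.
  by move: c cs; near: a.
apply: filterS near_s => a sa C [cC eC CM] Ca.
have sC : covers s C.
  have : (pickle @` [set F | covers F C0]) (pickle s) by exists s.
  by rewrite C0M -CM => -[s' s'C /(pcan_inj pickleK) <-].
by have [b bs /sa] := sC _ Ca; exact.
Unshelve. all: by end_near. Qed.

Lemma avoiding_dense (M : machine) : dense (avoiding M)°.
Proof.
move=> O [a0 Oa0] oO.
have /nbhs_ballP[e /= e0 eO] : nbhs a0 O by exact: open_nbhs_nbhs.
have [|p [q [oq pq]]] := @odd_fraction_between R a0 (a0 + e).
  by rewrite ltrDl.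
exists (p%:~R / q%:R); split.
  by apply: eO; rewrite /ball/= ltr_norml; lra.
by apply: near_avoiding; exact: rotation_law_odd_not_ergodic.
Qed.

(** Both families of conditions are merged into the single sequence that Baire's theorem takes; an
    index that codes nothing imposes no condition. *)
Definition generic_condition (i : nat) : set R :=
  match @unpickle (rat * nat + machine)%type i with
  | Some (inl (t, k)) => orbit_near t k
  | Some (inr M) => (avoiding M)°
  | None => setT
  end.

Lemma generic_rotation_exists : exists a : R,
  dense_orbit a /\ forall M, avoiding M a.
Proof.
have oD i : open (generic_condition i) /\ dense (generic_condition i).
  rewrite /generic_condition; case: unpickle => [[[t k]|M]|].
  - by split; [exact: orbit_near_open|exact: orbit_near_dense].
  - by split; [exact: open_interior|exact: avoiding_dense].
  - by split; [exact: openT|move=> O; rewrite setIT].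
have [a [_ ga]] := @Baire R R _ oD setT (ex_intro _ 0 I) openT.
exists a; split=> [|M].
  apply: dense_orbitP => t k.
  have := ga (pickle (inl (t, k) : rat * nat + machine)%type) I.
  by rewrite /generic_condition pickleK.
have := ga (pickle (inr M : rat * nat + machine)%type) I.
by rewrite /generic_condition pickleK => /interior_subset; exact.
Qed.

End generic_rotation.

Theorem theorem29 (R : realType) :
  exists P : probability Omega R,
    ergodic P /\
    forall C : set (probability Omega R),
      effectively_compact C -> C `<=` [set Q | ergodic Q] -> ~ C P.
Proof.
have [a [da aa]] := generic_rotation_exists R.
exists (rotation_law a); split; first exact: rotation_law_ergodic.
(* The machine [M] enumerating the finite covers of [C] captures [C], and [a] avoids every
   machine. *)
move=> C [cC [M CM]] eC; exact: (aa M).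
Qed.
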